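(* Let $\Delta$ be a division ring of characteristic zero. If every semigroup of unipotent matrices over $\Delta$ is triangularizable, then every semigroup of matrices of the form $cI + N$, where $c$ is in the center of $\Delta$ and $N$ is a nilpotent matrix with entries from $\Delta$, is triangularizable.
   Context: $M_n(\Delta)$ is the ring of all $n\times n$ matrices over $\Delta$ and $I$ is the identity matrix. A semigroup of matrices over $\Delta$ is a subset of $M_n(\Delta)$, for some positive integer $n$, closed under multiplication. A matrix is unipotent if it is of the form $I+N$ with $N$ nilpotent. Members of $M_n(\Delta)$ are viewed as linear transformations acting on the left of $\Delta^n$, the right $\Delta$-vector space of all $n\times 1$ column vectors. A semigroup $\mathcal{S} \subseteq M_n(\Delta)$ is called triangularizable if there is a chain of subspaces $\{0\} = \mathcal{V}_0 \subseteq \mathcal{V}_1 \subseteq \cdots \subseteq \mathcal{V}_n = \Delta^n$, where each $\mathcal{V}_j$ is a $j$-dimensional subspace invariant under every $S \in \mathcal{S}$. *)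

(* Defs.v *)
From HB Require Import structures.
From mathcomp Require Import all_boot all_order all_algebra.
From mathcomp Require Import boolp classical_sets.

Set Implicit Arguments.
Unset Strict Implicit.
Unset Printing Implicit Defensive.

Import GRing.Theory.
Local Open Scope ring_scope.
Local Open Scope classical_set_scope.

(* [GRing.field_axiom] only says that nonzero elements are units; as
   [unitRingType] is nontrivial and not assumed commutative, it defines
   division rings here. *)
Definition division_ring (D : unitRingType) : Prop := GRing.field_axiom D.

Definition char_zero (D : unitRingType) : Prop := [pchar D] =i pred0.

Definition central (D : unitRingType) (c : D) : Prop :=
  forall x : D, GRing.comm c x.

(* [^+] is the power in the ring 'M[D]_n, whose product is [*m]. *)
Definition nilpotent_mx (D : unitRingType) (n : nat) (N : 'M[D]_n) : Prop :=
  exists k : nat, N ^+ k = 0.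

Definition unipotent_mx (D : unitRingType) (n : nat) (A : 'M[D]_n) : Prop :=
  exists2 N : 'M[D]_n, nilpotent_mx N & A = 1%:M + N.

Definition central_plus_nilpotent_mx (D : unitRingType) (n : nat)
    (A : 'M[D]_n) : Prop :=
  exists c : D, exists N : 'M[D]_n,
    [/\ central c, nilpotent_mx N & A = c%:M + N].

Definition mx_semigroup (D : unitRingType) (n : nat) (S : set 'M[D]_n) : Prop :=
  forall A B : 'M[D]_n, S A -> S B -> S (A *m B).

(* Column vectors form a right D-space, whereas the library's [a *: v] is the
   left scaling, with which left multiplication by matrices does not commute. *)
Definition rscale (D : unitRingType) (n : nat) (v : 'cV[D]_n) (a : D) :
  'cV[D]_n := \col_i (v i 0 * a).

Definition rsubspace (D : unitRingType) (n : nat) (V : set 'cV[D]_n) : Prop :=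
  [/\ V 0,
      forall u v : 'cV[D]_n, V u -> V v -> V (u + v)
    & forall (v : 'cV[D]_n) (a : D), V v -> V (rscale v a)].

Definition rlincomb (D : unitRingType) (n j : nat) (b : 'I_j -> 'cV[D]_n)
    (x : 'I_j -> D) : 'cV[D]_n := \sum_(k < j) rscale (b k) (x k).

Definition rbasis (D : unitRingType) (n j : nat) (b : 'I_j -> 'cV[D]_n)
    (V : set 'cV[D]_n) : Prop :=
  (forall x : 'I_j -> D, rlincomb b x = 0 -> forall k, x k = 0) /\
  V = range (rlincomb b).

Definition rdim (D : unitRingType) (n : nat) (V : set 'cV[D]_n) (j : nat) :
  Prop := exists b : 'I_j -> 'cV[D]_n, rbasis b V.

Definition invariant (D : unitRingType) (n : nat) (V : set 'cV[D]_n)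
    (A : 'M[D]_n) : Prop :=
  forall v : 'cV[D]_n, V v -> V (A *m v).

Definition triangularizable (D : unitRingType) (n : nat) (S : set 'M[D]_n) :
  Prop :=
  exists V : 'I_n.+1 -> set 'cV[D]_n,
    [/\ V ord0 = [set 0],
        V ord_max = [set: 'cV[D]_n],
        forall i j : 'I_n.+1, (i <= j)%N -> V i `<=` V j
      & forall j : 'I_n.+1,
          [/\ rsubspace (V j), rdim (V j) j
            & forall A : 'M[D]_n, S A -> invariant (V j) A]].

(* Main.v *)
From HB Require Import structures.
Require Import Defs.
From mathcomp Require Import all_boot all_order all_algebra.
From mathcomp Require Import boolp classical_sets.

Set Implicit Arguments.
Unset Strict Implicit.
Unset Printing Implicit Defensive.

Import GRing.Theory.
Local Open Scope ring_scope.
Local Open Scope classical_set_scope.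

(** The proof is by induction on the dimension, and splits according to whether
the semigroup [S] has an invariant subspace other than zero and the whole space.

If it has one, a basis adapted to that subspace makes every member of [S] block
triangular ([subspace_splits]).  The diagonal blocks form semigroups of the same
kind in smaller dimension, and chains for them glue to a chain for [S]
([triangularizable_glue]).

If [S] is irreducible, its nilpotent members form an ideal.  A nonzero one, [A],
of least rank would satisfy [A B A = 0] for every [B] in the ideal, and then the
common kernels of two families of products give invariant subspaces that cannot
exist; so zero is the only nilpotent member ([irreducible_nilpotent_eq0]).
Every other member is [c U] with [c] central and nonzero and [U] unipotent, and
has the same invariant subspaces as [U].  It remains to see that these [U] form a
semigroup, to which the hypothesis on unipotent semigroups then applies.

So let [U] and [V] be such that each [U ^ k V] is a central scalar [l_k] plus a
nilpotent matrix; the point is that [l_1 = 1] ([unipotent_product]).  As [U] is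
unipotent and the characteristic is zero, [U ^ k V = P(k)] for a polynomial [P]
with matrix coefficients, and the inverses are polynomial in [k] as well.
Over a division ring there is no usable trace or determinant to compute [l_k];
instead, let [r] be least such that [(P(k) - l_k) ^ r = 0] for infinitely many
[k].  For these [k], apart from finitely many, [P(k) ^ r] is a unique combination
of the lower powers over the center [F], with [r l_k] among its coefficients.
Taking coordinates over [F] and using Cramer's rule, [l_k] is the value at [k] of
a rational function [a / b] over [F] ([eigenvalue_rational]), and hence
[(a - b P) ^ r = 0] identically.  With [a] and [b] coprime, Bezout shows that [b]
divides 1, and that [a] does because [P] is invertible
([coprime_nilpotent_const]).  So [a / b] is a constant; it is 1 because
[P(0) = V] is unipotent, and thus [P(1) = U V] is unipotent. *)

(** * Polynomials in an integer variable with coefficients in an algebra *)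

Definition infinitely_often (Q : nat -> Prop) : Prop :=
  forall m, exists2 k, (m <= k)%N & Q k.

Definition nilpotent_elt (A : nzRingType) (x : A) : Prop :=
  exists k, x ^+ k = 0.

Lemma char0_natr_neq0 (F : fieldType) (F0 : [pchar F] =i pred0) k :
  (0 < k)%N -> k%:R != 0 :> F.
Proof. by move=> k0; rewrite ((pcharf0P F).1 F0) -lt0n. Qed.

(** Differences of distinct integers are invertible and central, so that roots
can be split off one at a time although [A] may be noncommutative with zero
divisors. *)
Lemma poly0_infinitely_often (F : fieldType) (A : nzRingType)
    (phi : {rmorphism F -> A}) (F0 : [pchar F] =i pred0) (p : {poly A}) :
  infinitely_often (fun k => p.[k%:R] = 0) -> p = 0.
Proof.
move: {2}(size p) (leqnn (size p)) => d.
elim: d p => [|d IHd] p; first by rewrite size_poly_leq0 => /eqP.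
move=> szp p_inf; have [k _ pk0] := p_inf 0%N.
have /factor_theorem[q Dp] : root p k%:R by apply/eqP.
suff q0 : q = 0 by rewrite Dp q0 mul0r.
have [//|nz_q] := eqVneq q 0; apply: IHd.
  by rewrite Dp size_Mmonic ?monicXsubC // size_XsubC addn2 in szp.
(* Beyond [k], a root of [p] is a root of [q]. *)
move=> m; have [k' le_m_k' pk'0] := p_inf (maxn m k.+1).
move: le_m_k'; rewrite geq_max => /andP[le_mk' lt_kk'].
exists k' => //; move: pk'0; rewrite Dp hornerM_comm; last first.
  by rewrite /comm_poly hornerXsubC; apply/esym/commr_nat.
rewrite hornerXsubC -natrB ?(ltnW lt_kk') // => qk0.
have u : (k' - k)%:R != 0 :> F by rewrite char0_natr_neq0 // subn_gt0.
have: q.[k'%:R] * phi ((k' - k)%:R * (k' - k)%:R^-1) = 0.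
  by rewrite rmorphM rmorph_nat mulrA qk0 mul0r.
by rewrite mulfV // rmorph1 mulr1.
Qed.

(** The binomial expansion of [(1 + x) ^ k] stops at the nilpotency index of [x],
and in characteristic zero each binomial coefficient is a polynomial in [k]. *)
Lemma unipotent_pow_poly (F : fieldType) (A : nzRingType)
    (phi : {rmorphism F -> A}) (F0 : [pchar F] =i pred0) (x : A) :
  nilpotent_elt x ->
  exists Q : {poly A}, forall k : nat, Q.[k%:R] = (1 + x) ^+ k.
Proof.
case=> p xp0.
have binP i : exists b : {poly F}, forall k : nat, b.[k%:R] = 'C(k, i)%:R.
  elim: i => [|i [b Db]]; first by exists 1 => k; rewrite hornerE bin0.
  exists ((i.+1%:R^-1)%:P * (('X - i%:R%:P) * b)) => k.
  rewrite !hornerM hornerC hornerXsubC Db; apply: (mulfI (char0_natr_neq0 F0 (ltn0Sn i))).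
  rewrite mulVKf ?char0_natr_neq0 // -natrM mul_bin_left natrM.
  have [le_ik|lt_ki] := leqP i k; first by rewrite natrB.
  by rewrite bin_small // !mulr0.
have [b Db] := choice binP.
exists (\sum_(i < p) (x ^+ i)%:P * map_poly phi (b i)) => k.
rewrite horner_sum.
(* A sum of [p + k.+1] terms covers both the [k.+1] terms of the binomial formula
   and the [p] terms of the polynomial; all other terms vanish. *)
have -> : (1 + x) ^+ k = \sum_(i < p + k.+1) x ^+ i *+ 'C(k, i).
  rewrite addrC exprDn_comm; last exact: commr1.
  rewrite addnC big_split_ord /= [X in _ + X]big1 ?addr0 => [|i _].
    rewrite (reindex_inj rev_ord_inj) /=; apply: eq_bigr => i _.
    have le_ik : (i <= k)%N by rewrite -ltnS.
    by rewrite subSS expr1n mulr1 subKn // bin_sub.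
  by rewrite bin_small ?mulr0n // ltnS leq_addr.
rewrite big_split_ord /= [X in _ = _ + X]big1 ?addr0 => [|i _]; last first.
  by rewrite exprD xp0 mul0r mul0rn.
apply: eq_bigr => i _; rewrite hornerCM.
have -> : (map_poly phi (b i)).[k%:R] = phi (b i).[k%:R].
  by rewrite -(rmorph_nat phi) horner_map.
by rewrite Db rmorph_nat mulr_natr.
Qed.

(** * Linear algebra over a central field *)

(** Coefficients are indexed by all of [nat], so that extending [e] does not
change their type. *)
Definition lincomb (F : fieldType) (A : nzRingType) (phi : F -> A)
    (e : seq A) (c : nat -> F) : A := \sum_(i < size e) phi (c i) * e`_i.

Definition lin_indep (F : fieldType) (A : nzRingType) (phi : F -> A)
    (e : seq A) : Prop :=
  forall c, lincomb phi e c = 0 -> forall i, (i < size e)%N -> c i = 0.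

Lemma lincomb_rcons (F : fieldType) (A : nzRingType) (phi : F -> A) e x c :
  lincomb phi (rcons e x) c = lincomb phi e c + phi (c (size e)) * x.
Proof.
rewrite /lincomb size_rcons big_ord_recr /= nth_rcons ltnn eqxx.
by congr (_ + _); apply: eq_bigr => i _; rewrite nth_rcons ltn_ord.
Qed.

Lemma lincombB (F : fieldType) (A : nzRingType) (phi : {rmorphism F -> A})
    e c d :
  lincomb phi e (fun i => c i - d i) = lincomb phi e c - lincomb phi e d.
Proof.
by rewrite /lincomb -sumrB; apply: eq_bigr => i _; rewrite rmorphB mulrBl.
Qed.

Lemma lin_indep_rcons (F : fieldType) (A : nzRingType)
    (phi : {rmorphism F -> A}) e x :
  lin_indep phi e -> (~ exists c, x = lincomb phi e c) ->
  lin_indep phi (rcons e x).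
Proof.
move=> e_ind x_out c; rewrite lincomb_rcons => c0.
have ce0 : c (size e) = 0.
  have [//|nz_c] := eqVneq (c (size e)) 0; case: x_out.
  exists (fun i => - ((c (size e))^-1 * c i)).
  rewrite -[LHS]mul1r -(rmorph1 phi) -(mulVf nz_c) rmorphM -mulrA.
  have -> : phi (c (size e)) * x = - lincomb phi e c.
    by apply/eqP; rewrite -addr_eq0 addrC c0.
  rewrite mulrN /lincomb mulr_sumr -sumrN; apply: eq_bigr => i _.
  by rewrite mulrA -rmorphM rmorphN mulNr.
move=> i; rewrite size_rcons ltnS leq_eqVlt => /predU1P[-> //|lt_ie].
by apply: e_ind lt_ie; rewrite ce0 rmorph0 mul0r addr0 in c0.
Qed.

Lemma lincomb_cat (F : fieldType) (A : nzRingType)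
    (phi : {rmorphism F -> A}) e f c :
  lincomb phi e c =
  lincomb phi (e ++ f) (fun i => if (i < size e)%N then c i else 0).
Proof.
rewrite /lincomb size_cat big_split_ord /= [X in _ = _ + X]big1 ?addr0.
  by apply: eq_bigr => i _; rewrite nth_cat ltn_ord.
by move=> i _; rewrite ltnNge leq_addr /= rmorph0 mul0r.
Qed.

Lemma lin_indep_extend (F : fieldType) (A : nzRingType)
    (phi : {rmorphism F -> A}) (s e : seq A) :
  lin_indep phi e ->
  exists2 f, lin_indep phi (e ++ f) &
    forall x, x \in s -> exists c, x = lincomb phi (e ++ f) c.
Proof.
elim: s e => [|x s IHs] e e_ind; first by exists [::]; rewrite ?cats0.
have [[c Dx]|x_out] := pselect (exists c, x = lincomb phi e c).
  have [f ef_ind ef_span] := IHs e e_ind; exists f => // y.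
  rewrite inE => /predU1P[->|/ef_span //].
  by rewrite Dx (lincomb_cat phi e f); eexists.
have [f] := IHs _ (lin_indep_rcons e_ind x_out).
rewrite cat_rcons => ef_ind ef_span; exists (x :: f) => // y.
rewrite inE => /predU1P[->|/ef_span //].
have := lincomb_cat phi (rcons e x) f
  (fun i => if (i < size e)%N then 0 else 1).
rewrite cat_rcons => lc; eexists; apply: etrans lc.
rewrite lincomb_rcons ltnn rmorph1 mul1r.
by rewrite /lincomb big1 ?add0r // => i _; rewrite ltn_ord rmorph0 mul0r.
Qed.

(** The minimal polynomial of [y] is [(X - l) ^ r.+1]. If a nonzero polynomial
[p] of degree at most [r] killed [y], its part prime to [X - l] could be inverted
at [y], and a power of [y - l] at most the [r]-th would vanish. *)
Lemma powers_lin_indep (F : fieldType) (A : nzRingType)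
    (phi : {rmorphism F -> A}) (phiC : forall c x, GRing.comm x (phi c))
    (y : A) (l : F) (r : nat) :
  (y - phi l) ^+ r.+1 = 0 -> (y - phi l) ^+ r <> 0 ->
  lin_indep phi (mkseq (fun j => y ^+ j) r.+1).
Proof.
move=> yr0 nz_yr c; rewrite /lincomb size_mkseq => c0 i lt_ir.
have yC : commr_rmorph phi y by move=> z; apply: phiC.
pose ev : {rmorphism {poly F} -> A} := horner_morph yC; pose p := \poly_(j < r.+1) c j.
have evp : ev p = 0.
  rewrite /p poly_def rmorph_sum /= -[RHS]c0; apply: eq_bigr => j _.
  by rewrite -mul_polyC rmorphM rmorphXn /= horner_morphC horner_morphX nth_mkseq.
have [p0|nz_p] := eqVneq p 0.
  by have := coef_poly r.+1 c i; rewrite -/p p0 coef0 lt_ir.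
have [m [q qP Dp]] := multiplicity_XsubC p l.
rewrite nz_p /= in qP.
have evX : ev ('X - l%:P) = y - phi l.
  by rewrite rmorphB /= horner_morphX horner_morphC.
have : coprimep q (('X - l%:P) ^+ r.+1).
  by rewrite coprimep_expr // coprimep_XsubC.
case/Bezout_eq1_coprimepP => -[u v] /= Duv.
have uq1 : ev u * ev q = 1.
  rewrite -(rmorph1 ev) -Duv rmorphD !rmorphM /= rmorphXn /= evX yr0.
  by rewrite mulr0 addr0.
have ym0 : (y - phi l) ^+ m = 0.
  by rewrite -[LHS]mul1r -uq1 -mulrA -evX -rmorphXn -rmorphM -Dp evp mulr0.
have le_mr : (m <= r)%N.
  have nz_q : q != 0 by apply: contraNneq qP => ->; rewrite root0.
  have := size_poly r.+1 c; rewrite -/p Dp size_Mmonic ?monic_exp ?monicXsubC //.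
  rewrite size_exp_XsubC addnS /= -(ltnS m) => /(leq_trans _); apply.
  by rewrite -[(m < _)%N]/(1 + m <= _)%N leq_add2r lt0n size_poly_eq0.
by case: nz_yr; rewrite -(subnK le_mr) exprD ym0 mulr0.
Qed.

Lemma lincomb_sum (F : fieldType) (A : nzRingType) (phi : {rmorphism F -> A})
    (e : seq A) n (a : 'I_n -> F) (c : 'I_n -> nat -> F) :
  lincomb phi e (fun l => \sum_j a j * c j l) =
  \sum_j phi (a j) * lincomb phi e (c j).
Proof.
rewrite /lincomb; under [RHS]eq_bigr do rewrite mulr_sumr.
rewrite exchange_big; apply: eq_bigr => i _.
rewrite rmorph_sum mulr_suml; apply: eq_bigr => j _.
by rewrite rmorphM mulrA.
Qed.

Lemma lincomb_inj (F : fieldType) (A : nzRingType) (phi : {rmorphism F -> A})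
    (e : seq A) c d :
  lin_indep phi e -> lincomb phi e c = lincomb phi e d ->
  forall l, (l < size e)%N -> c l = d l.
Proof.
move=> e_ind eq_cd l lt_l; apply/eqP; rewrite -subr_eq0; apply/eqP.
by apply: (e_ind (fun i => c i - d i)) lt_l; rewrite lincombB eq_cd subrr.
Qed.

(** * Rationality of the eigenvalue *)

(** The powers of [P.[k0]] up to the [r]-th start a basis in which the
coefficients of the powers of [P] have coordinates. The determinant of the
leading coordinates of [1, P, .., P ^ r] is a polynomial, equal to 1 at [k0];
whenever [(P - lam) ^ r.+1 = 0] at [k], Cramer's rule recovers from it the
coefficient [r.+1 * lam k] of [P ^ r] in the expansion of [P ^ r.+1]. *)
Lemma eigenvalue_rational (F : fieldType) (A : nzRingType)
    (phi : {rmorphism F -> A}) (F0 : [pchar F] =i pred0)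
    (phiC : forall c x, GRing.comm x (phi c))
    (P : {poly A}) (lam : nat -> F) (r k0 : nat) :
  (P.[k0%:R] - phi (lam k0)) ^+ r.+1 = 0 ->
  (P.[k0%:R] - phi (lam k0)) ^+ r <> 0 ->
  exists a b : {poly F}, b != 0 /\
    forall k, (P.[k%:R] - phi (lam k)) ^+ r.+1 = 0 ->
      b.[k%:R] * lam k = a.[k%:R].
Proof.
move=> k0r k0r'; set e := mkseq (fun j => P.[k0%:R] ^+ j) r.+1.
have e_ind : lin_indep phi e by apply: powers_lin_indep k0r k0r'.
pose s := [seq (P ^+ j)`_i | j <- iota 0 r.+2, i <- iota 0 (size (P ^+ j))].
have [f ef_ind ef_span] := lin_indep_extend s e_ind.
set g := e ++ f in ef_ind ef_span.
have coordP (ji : nat * nat) : exists c : nat -> F, (ji.1 < r.+2)%N ->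
    (ji.2 < size (P ^+ ji.1)%R)%N -> (P ^+ ji.1)`_ji.2 = lincomb phi g c.
  have [ltj|_] := ltnP ji.1 r.+2; last by exists (fun=> 0).
  have [lti|_] := ltnP ji.2 (size (P ^+ ji.1)); last by exists (fun=> 0).
  have [|c Dc] := ef_span (P ^+ ji.1)`_ji.2; last by exists c.
  by apply: allpairs_f_dep; rewrite mem_iota.
have [c Dc] := choice coordP.
pose q j l := \poly_(i < size (P ^+ j)) c (j, i) l.
have Pq j k : (j < r.+2)%N ->
    P.[k%:R] ^+ j = lincomb phi g (fun l => (q j l).[k%:R]).
  move=> lt_j; rewrite -horner_exp_comm; last exact/esym/commr_nat.
  rewrite horner_coef.
  have kE i : k%:R ^+ i = phi (k%:R ^+ i) by rewrite rmorphXn rmorph_nat.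
  transitivity (\sum_(i < size (P ^+ j)) phi (k%:R ^+ i) * lincomb phi g (c (j, val i))).
    by apply: eq_bigr => i _; rewrite kE (Dc (j, val i)) //= -phiC.
  rewrite -lincomb_sum; congr lincomb; apply/funext => l.
  rewrite horner_poly; apply: eq_bigr => i _.
  exact: mulrC.
have sz_g (l : 'I_r.+1) : (l < size g)%N.
  by rewrite size_cat size_mkseq ltn_addr.
pose M := \matrix_(j < r.+1, l < r.+1) q j l.
pose R := \row_(l < r.+1) q r.+1 l.
(* At [k0] the first [r.+1] powers of [P] are the first basis vectors. *)
have detM : \det M != 0.
  suff: (\det M).[k0%:R] != 0 by apply: contraNneq => ->; rewrite horner0.
  rewrite -[(\det M).[_]]/(horner_eval k0%:R (\det M)) -det_map_mx.
  suff -> : map_mx (horner_eval k0%:R) M = 1%:M by rewrite det1 oner_eq0.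
  apply/matrixP => j l; rewrite !mxE /horner_eval.
  have lt_j : (j < r.+2)%N by rewrite ltnS ltnW.
  pose d (i : nat) : F := ((j : nat) == i)%:R.
  have -> : (j == l)%:R = d l by [].
  apply: (lincomb_inj (c := fun l => (q j l).[k0%:R]) ef_ind) => //.
  rewrite -Pq //  /lincomb (bigD1 (Ordinal (sz_g j))) //= big1 ?addr0.
    by rewrite /d eqxx rmorph1 mul1r nth_cat size_mkseq ltn_ord nth_mkseq.
  move=> i; rewrite -val_eqE /= eq_sym /d => /negPf->.
  by rewrite rmorph0 mul0r.
exists ((R *m \adj M) 0 ord_max), (r.+1%:R%:P * \det M); split.
  by rewrite mulf_neq0 // polyC_eq0 char0_natr_neq0.
(* [a] lists the coefficients of [P ^ r.+1] on lower powers when the index at [k]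
   is at most [r.+1]; its last entry is [r.+1 * lam k]. *)
move=> k kr0; pose a (j : nat) := - ((- lam k) ^+ (r.+1 - j) *+ 'C(r.+1, j)).
have Pr : P.[k%:R] ^+ r.+1 = \sum_(j < r.+1) phi (a j) * P.[k%:R] ^+ j.
  move: kr0; rewrite addrC exprDn_comm; last exact/esym/commrN/phiC.
  rewrite big_ord_recr /= subnn mul1r binn mulr1n addrC.
  move/eqP; rewrite addr_eq0 -sumrN => /eqP->; apply: eq_bigr => j _.
  by rewrite rmorphN rmorphMn rmorphXn rmorphN mulNr mulrnAl.
have DR : map_mx (horner_eval k%:R) R =
    (\row_j a j) *m map_mx (horner_eval k%:R) M.
  apply/rowP => l; rewrite !mxE /horner_eval.
  under eq_bigr do rewrite !mxE.
  have := @lincomb_inj _ _ phi g (fun l => (q r.+1 l).[k%:R])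
    (fun l => \sum_(j < r.+1) a j * (q j l).[k%:R]) ef_ind.
  apply=> //; rewrite -Pq // Pr lincomb_sum; apply: eq_bigr => j _.
  by rewrite -Pq // ltnS ltnW.
have := congr1 (mulmx^~ (\adj (map_mx (horner_eval k%:R) M))) DR.
rewrite -mulmxA mul_mx_adj -map_mx_adj -map_mxM det_map_mx.
move/matrixP/(_ 0 ord_max); rewrite [LHS]mxE /= {1}/horner_eval => ->.
rewrite [RHS]mxE.
rewrite (bigD1 ord_max) //= big1 ?addr0 => [|j nj]; last first.
  by rewrite !mxE (negPf nj) mulr0n mulr0.
rewrite !mxE eqxx mulr1n /a subSnn expr1 binSn hornerM hornerC.
by rewrite mulNrn opprK -[lam k *+ _]mulr_natl mulrAC.
Qed.

(** * Products of unipotent elements *)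

Lemma expr_right_inv (A : pzRingType) (x w : A) k :
  x * w = 1 -> x ^+ k * w ^+ k = 1.
Proof.
move=> xw1; elim: k => [|k IHk]; first by rewrite !expr0 mulr1.
by rewrite exprSr exprS mulrA -(mulrA _ x) xw1 mulr1.
Qed.

(** The inverse is the geometric series in [- u]. *)
Lemma unipotent_inv (A : nzRingType) (u : A) : nilpotent_elt u ->
  exists w, [/\ nilpotent_elt w, (1 + u) * (1 + w) = 1 & (1 + w) * (1 + u) = 1].
Proof.
case=> k uk0; pose s := \sum_(i < k) (- u) ^+ i.
have uk0' : (- u) ^+ k = 0 by rewrite exprNn uk0 mulr0.
have us : (1 + u) * s = 1.
  have := subrX1 (- u) k; rewrite uk0' sub0r -opprD mulNr => /oppr_inj.
  by rewrite addrC.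
have cus : GRing.comm u s.
  apply: commr_sum => i _; apply: commrX; apply: commrN; exact: commr_refl.
exists (s - 1); have -> : 1 + (s - 1) = s by rewrite addrC subrK.
split=> //; last first.
  by rewrite mulrDr mulr1 -cus -[X in X + _]mul1r -mulrDl.
exists k; have -> : s - 1 = - (u * s).
  by rewrite -{1}us mulrDl mul1r opprD addrA subrr add0r.
by rewrite exprNn exprMn_comm // uk0 mul0r mulr0.
Qed.

Lemma scalar_add_nilpotent_inv (F : fieldType) (A : nzRingType)
    (phi : {rmorphism F -> A}) (phiC : forall c x, GRing.comm x (phi c))
    (d : F) (y : A) : d != 0 -> nilpotent_elt y ->
  exists w, (phi d + y) * w = 1 /\ w * (phi d + y) = 1.
Proof.
move=> nz_d [k yk0].
have [|w [_ yw1 wy1]] := @unipotent_inv _ (phi d^-1 * y).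
  by exists k; rewrite exprMn_comm ?yk0 ?mulr0 //; apply/commr_sym/phiC.
have -> : phi d + y = phi d * (1 + phi d^-1 * y).
  by rewrite mulrDr mulr1 mulrA -rmorphM mulfV // rmorph1 mul1r.
exists ((1 + w) * phi d^-1); split.
  by rewrite mulrA -(mulrA (phi d)) yw1 mulr1 -rmorphM mulfV ?rmorph1.
by rewrite mulrA -(mulrA (1 + w)) -rmorphM mulVf // rmorph1 mulr1.
Qed.

Lemma nilpotent_shift_eq0 (F : fieldType) (A : nzRingType)
    (phi : {rmorphism F -> A}) (phiC : forall c x, GRing.comm x (phi c))
    (d : F) (y : A) :
  nilpotent_elt y -> nilpotent_elt (phi d + y) -> d = 0.
Proof.
move=> y_nil [r xr0]; have [//|nz_d] := eqVneq d 0.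
have [w [xw1 _]] := scalar_add_nilpotent_inv phiC nz_d y_nil.
have := expr_right_inv r xw1; rewrite xr0 mul0r => /esym/eqP.
by rewrite oner_eq0.
Qed.

Lemma map_poly_comm (F : fieldType) (A : nzRingType)
    (phi : {rmorphism F -> A}) (phiC : forall c x, GRing.comm x (phi c))
    (f : {poly F}) (X : {poly A}) : GRing.comm X (map_poly phi f).
Proof.
apply/polyP => i; rewrite coefM coefMr; apply: eq_bigr => j _.
by rewrite coef_map; apply: phiC.
Qed.

(** The leading coefficient of [f] is invertible and central in [A], so that
degrees add although [A] may have zero divisors. *)
Lemma map_poly_mul_size (F : fieldType) (A : nzRingType)
    (phi : {rmorphism F -> A}) (f : {poly F}) (X : {poly A}) :
  f != 0 -> X != 0 ->
  size (map_poly phi f * X) = (size f + size X).-1.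
Proof.
move=> nz_f nz_X; rewrite size_proper_mul ?size_map_poly //.
rewrite lead_coef_map; apply: contra nz_X => /eqP fX0; rewrite -lead_coef_eq0.
rewrite -[lead_coef X]mul1r -(rmorph1 phi) -(mulVf (x := lead_coef f)) ?lead_coef_eq0 //.
by rewrite rmorphM -mulrA fX0 mulr0.
Qed.

Lemma map_poly_mul_eq0 (F : fieldType) (A : nzRingType)
    (phi : {rmorphism F -> A}) (f : {poly F}) (X : {poly A}) :
  f != 0 -> map_poly phi f * X = 0 -> X = 0.
Proof.
move=> nz_f fX0; have [//|nz_X] := eqVneq X 0.
have := map_poly_mul_size phi nz_f nz_X; rewrite fX0 size_poly0.
by move: nz_f nz_X; rewrite -!size_poly_gt0; do 2!case: (size _) => // ?; rewrite addnS.
Qed.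

(** Since [f] and [g] are central, the nilpotency makes [g ^ r] a multiple of
[f]; as [g ^ r] is also coprime to [f], so is 1. *)
Lemma coprime_nilpotent_const (F : fieldType) (A : nzRingType)
    (phi : {rmorphism F -> A}) (phiC : forall c x, GRing.comm x (phi c))
    (f g : {poly F}) (X : {poly A}) r :
  coprimep f g -> (map_poly phi g - map_poly phi f * X) ^+ r = 0 ->
  exists2 c, c != 0 & f = c%:P.
Proof.
move=> cfg; set f' := map_poly phi f; set g' := map_poly phi g => gfX0.
have cxy : GRing.comm g' (g' - f' * X) by apply/commr_sym/map_poly_comm.
have := subrXX_comm r cxy; rewrite gfX0 subr0 opprB addrC subrK.
set Z := \sum_(i < r) _ => DZ.
have /Bezout_eq1_coprimepP[[s t] /= Dst] : coprimep f (g ^+ r).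
  by rewrite coprimep_expr.
have := congr1 (map_poly phi) Dst.
rewrite rmorphD !rmorphM rmorphXn rmorph1 -/f' -/g' /= DZ.
have f'C Y : Y * f' = f' * Y by apply: map_poly_comm.
rewrite -(mulrA f') [map_poly phi t * _]mulrA !f'C -(mulrA f') -mulrDr.
set W := (X in f' * X) => fW1.
have nz_f : f != 0.
  by apply: contra_eqN fW1 => /eqP f0; rewrite /f' f0 rmorph0 mul0r eq_sym oner_eq0.
have nz_W : W != 0.
  by apply: contra_eqN fW1 => /eqP->; rewrite mulr0 eq_sym oner_eq0.
have := map_poly_mul_size phi nz_f nz_W; rewrite fW1 size_poly1.
have := nz_f; rewrite -size_poly_gt0; have := nz_W; rewrite -size_poly_gt0.
case: (size W) => // w _ szf; rewrite addnS /= => szfw.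
have /size_poly1P[c nz_c Df] : size f == 1%N by move: szf szfw; case: (size f) => [|[|]].
by exists c.
Qed.

Lemma hornerM_nat (A : nzRingType) (p q : {poly A}) k :
  (p * q).[k%:R] = p.[k%:R] * q.[k%:R].
Proof. by apply: hornerM_comm; apply/esym/commr_nat. Qed.

Lemma hornerX_nat (A : nzRingType) (p : {poly A}) r k :
  (p ^+ r).[k%:R] = p.[k%:R] ^+ r.
Proof. by apply: horner_exp_comm; apply/esym/commr_nat. Qed.

Lemma map_poly_horner_nat (F : fieldType) (A : nzRingType)
    (phi : {rmorphism F -> A}) (f : {poly F}) k :
  (map_poly phi f).[k%:R] = phi f.[k%:R].
Proof. by rewrite -(rmorph_nat phi) horner_map. Qed.

(** The exponent [r] is chosen least among those that work for infinitely many
[k]; this provides the point where the index is exactly [r] that the rational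
expression of the eigenvalue requires. *)
Lemma eigenvalue_fraction (F : fieldType) (A : nzRingType)
    (phi : {rmorphism F -> A}) (F0 : [pchar F] =i pred0)
    (phiC : forall c x, GRing.comm x (phi c))
    (P : {poly A}) n :
  (forall k : nat, exists l, (P.[k%:R] - phi l) ^+ n = 0) ->
  exists (a b : {poly F}) r, coprimep b a /\
    (map_poly phi a - map_poly phi b * P) ^+ r = 0.
Proof.
move=> /choice[lam Plam].
pose good r := infinitely_often (fun k => (P.[k%:R] - phi (lam k)) ^+ r = 0).
have ex_good : exists r, `[< good r >].
  by exists n; apply/asboolP => m; exists m.
have := ex_minnP ex_good => -[[|r] /asboolP good_r min_r].
  have [k _ /eqP] := good_r 0%N; by rewrite expr0 oner_eq0.
(* By minimality of [r.+1], the index is at most [r] for finitely many [k] only. *)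
have [k0 Pk0 nz_Pk0] : exists2 k0, (P.[k0%:R] - phi (lam k0)) ^+ r.+1 = 0
    & (P.[k0%:R] - phi (lam k0)) ^+ r <> 0.
  apply: contrapT => no_k0; have := min_r r; rewrite ltnn => /implyP/=.
  suff -> : `[< good r >] by [].
  apply/asboolP => m; have [k le_mk Pk] := good_r m; exists k => //.
  by apply: contrapT => nz_Pk; apply: no_k0; exists k.
have [a [b [nz_b Dab]]] := eigenvalue_rational F0 phiC Pk0 nz_Pk0.
pose g := gcdp b a; have nz_g : g != 0 by rewrite gcdp_eq0 (negPf nz_b).
have Db : b %/ g * g = b by rewrite divpK // dvdp_gcdl.
have Da : a %/ g * g = a by rewrite divpK // dvdp_gcdr.
exists (a %/ g), (b %/ g), r.+1; split; first by rewrite coprimep_div_gcd ?nz_b.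
apply: (@map_poly_mul_eq0 _ _ phi (g ^+ r.+1)); first by rewrite expf_neq0.
rewrite rmorphXn /= -exprMn_comm; last exact/commr_sym/map_poly_comm.
rewrite mulrBr mulrA -!rmorphM /= ![g * _]mulrC Db Da.
apply: (poly0_infinitely_often phi F0) => m.
have [k le_mk Pk] := good_r m; exists k => //.
rewrite hornerX_nat hornerD hornerN hornerM_nat !map_poly_horner_nat.
rewrite -Dab // rmorphM -mulrBr exprMn_comm; last exact/commr_sym/phiC.
by rewrite -opprB exprNn Pk !mulr0.
Qed.

(** A scalar that is a rational function with neither zeros nor poles is
constant: poles are excluded because [P] is a polynomial, and zeros because its
inverse [P'] is one. *)
Theorem unipotent_product (F : fieldType) (A : nzRingType)
    (phi : {rmorphism F -> A}) (F0 : [pchar F] =i pred0)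
    (phiC : forall c x, GRing.comm x (phi c)) (u v : A) n :
  nilpotent_elt u -> nilpotent_elt v ->
  (forall k, exists l, ((1 + u) ^+ k * (1 + v) - phi l) ^+ n = 0) ->
  nilpotent_elt ((1 + u) * (1 + v) - 1).
Proof.
move=> u_nil v_nil uv_eig.
have [u' [u'_nil uu' u'u]] := unipotent_inv u_nil.
have [v' [v'_nil vv' v'v]] := unipotent_inv v_nil.
have [Q DQ] := unipotent_pow_poly phi F0 u_nil.
have [Q' DQ'] := unipotent_pow_poly phi F0 u'_nil.
pose P := Q * (1 + v)%:P; pose P' := (1 + v')%:P * Q'.
have DP k : P.[k%:R] = (1 + u) ^+ k * (1 + v) by rewrite hornerM_nat hornerC DQ.
have DP' k : P'.[k%:R] = (1 + v') * (1 + u') ^+ k by rewrite hornerCM DQ'.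
have PP' : P * P' = 1.
  apply/eqP; rewrite -subr_eq0; apply/eqP.
  apply: (poly0_infinitely_often phi F0) => m; exists m => //.
  rewrite hornerD hornerN hornerC hornerM_nat DP DP' mulrA -(mulrA _ (1 + v)).
  by rewrite vv' mulr1 expr_right_inv // subrr.
have P'P : P' * P = 1.
  apply/eqP; rewrite -subr_eq0; apply/eqP.
  apply: (poly0_infinitely_often phi F0) => m; exists m => //.
  rewrite hornerD hornerN hornerC hornerM_nat DP DP' mulrA -(mulrA (1 + v')).
  by rewrite expr_right_inv // mulr1 v'v subrr.
have [|a [b [r [cba abP0]]]] := @eigenvalue_fraction _ _ phi F0 phiC P n.
  by move=> k; rewrite DP.
have baP0 : (map_poly phi b - map_poly phi a * P') ^+ r = 0.
  have -> : map_poly phi b - map_poly phi a * P' =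
      - ((map_poly phi a - map_poly phi b * P) * P').
    by rewrite mulrBl -mulrA PP' mulr1 opprB.
  rewrite exprNn exprMn_comm ?abP0 ?mul0r ?mulr0 //.
  apply: commr_sym; apply: commrB; first exact: map_poly_comm.
  by apply: commrM; [apply: map_poly_comm | rewrite /GRing.comm PP' P'P].
have [be nz_be Db] := coprime_nilpotent_const phiC cba abP0.
rewrite coprimep_sym in cba.
have [al nz_al Da] := coprime_nilpotent_const phiC cba baP0.
have eig k : (phi al - phi be * ((1 + u) ^+ k * (1 + v))) ^+ r = 0.
  have := congr1 (fun p => p.[k%:R]) abP0; rewrite horner0 hornerX_nat.
  by rewrite hornerD hornerN hornerM_nat !map_poly_horner_nat Da Db !hornerC DP.
(* At [k = 0] the unipotent element [1 + v] has eigenvalue [al / be]. *)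
have eq_ab : al - be = 0.
  apply: (@nilpotent_shift_eq0 _ _ _ phiC _ (- (phi be * v))).
    have [s vs0] := v_nil; exists s.
    by rewrite exprNn exprMn_comm ?vs0 ?mulr0 //; apply/commr_sym/phiC.
  exists r; rewrite -[RHS](eig 0%N) expr0 mul1r mulrDr mulr1 opprD addrA.
  by rewrite rmorphB.
exists r; apply: (@etrans _ _ (phi be^-1 ^+ r * (phi be * ((1 + u) * (1 + v) - 1)) ^+ r)).
  rewrite -exprMn_comm; last exact/commr_sym/phiC.
  by rewrite mulrA -rmorphM mulVf // rmorph1 mul1r.
rewrite -opprB mulrN mulrBr mulr1 exprNn.
by have := eig 1%N; move/eqP: eq_ab; rewrite subr_eq0 expr1 => /eqP-> ->; rewrite !mulr0.
Qed.

(** * The center of a division ring *)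

Definition center_pred (D : unitRingType) : {pred D} := fun x => `[< central x >].
Arguments center_pred : clear implicits.

Lemma center_predP (D : unitRingType) (x : D) :
  reflect (central x) (x \in center_pred D).
Proof. exact: asboolP. Qed.

Lemma center_divring_closed (D : unitRingType) : divring_closed (center_pred D).
Proof.
split=> [|x y /center_predP cx /center_predP cy|x y /center_predP cx /center_predP cy];
  apply/center_predP => z; apply: commr_sym.
- exact: commr1.
- by apply: commrB; apply: commr_sym.
- by apply: commrM; [|apply: commrV]; apply: commr_sym.
Qed.

HB.instance Definition _ (D : unitRingType) :=
  GRing.isDivringClosed.Build D (center_pred D) (@center_divring_closed D).

(** The proof that [D] is a division ring is a parameter of the type, so that the
field structure can be inferred. *)
Record center (D : unitRingType) (divD : division_ring D) :=
  Center { center_val :> D; center_valP : center_val \in center_pred D }.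

HB.instance Definition _ (D : unitRingType) (divD : division_ring D) :=
  [isSub for @center_val D divD].
HB.instance Definition _ (D : unitRingType) (divD : division_ring D) :=
  [Choice of center divD by <:].
HB.instance Definition _ (D : unitRingType) (divD : division_ring D) :=
  [SubChoice_isSubUnitRing of center divD by <:].

Lemma center_mulC (D : unitRingType) (divD : division_ring D) :
  commutative (@GRing.mul (center divD)).
Proof. by move=> x y; apply/val_inj/(center_predP _ (valP x)). Qed.

HB.instance Definition _ (D : unitRingType) (divD : division_ring D) :=
  GRing.PzRing_hasCommutativeMul.Build (center divD) (@center_mulC D divD).

Lemma center_field_axiom (D : unitRingType) (divD : division_ring D) :
  GRing.field_axiom (center divD).
Proof.
move=> x nz_x; have : val x \is a GRing.unit.
  by apply: (divD (val x)); apply: contra nz_x => /eqP x0; apply/eqP/val_inj.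
by move=> ux; apply/unitrP; exists x^-1; split; apply: val_inj; rewrite /= ?mulVr ?mulrV.
Qed.

HB.instance Definition _ (D : unitRingType) (divD : division_ring D) :=
  GRing.ComUnitRing_isField.Build (center divD) (@center_field_axiom D divD).

(** * Subspaces and adapted bases *)

Lemma rscaleE (D : unitRingType) n (v : 'cV[D]_n) a : rscale v a = v *m a%:M.
Proof.
by apply/matrixP => i j; rewrite !mxE big_ord1 !mxE !ord1 eqxx mulr1n.
Qed.

(** [W] is the range of [B] and the kernel of [G], and [C], [E] split the
    exact sequence [B], [G]. *)
Record splits (D : unitRingType) n m k (W : set 'cV[D]_n) (B : 'M[D]_(n, m))
    (C : 'M[D]_(n, k)) (E : 'M[D]_(m, n)) (G : 'M[D]_(k, n)) : Prop := Splits {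
  splits_EB : E *m B = 1%:M;
  splits_GC : G *m C = 1%:M;
  splits_EC : E *m C = 0;
  splits_GB : G *m B = 0;
  splits_1 : B *m E + C *m G = 1%:M;
  splits_ker : forall v, W v <-> G *m v = 0
}.

(** By induction on [n], splitting off the first coordinate: either it vanishes
on [W], and it is added to the complement, or [W] contains a vector with first
coordinate 1, which is added to the basis of [W]. *)
Lemma subspace_splits (D : unitRingType) (divD : division_ring D) n
    (W : set 'cV[D]_n) : rsubspace W ->
  exists m k (B : 'M[D]_(n, m)) (C : 'M[D]_(n, k)) (E : 'M[D]_(m, n))
    (G : 'M[D]_(k, n)), n = (m + k)%N /\ splits W B C E G.
Proof.
elim: n W => [|n IHn].
  move=> W [W0 _ _]; exists 0%N, 0%N, 0, 0, 0, 0; split=> //.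
  split; try by apply/matrixP => -[].
  by move=> v; split=> [_|_]; [|rewrite (_ : v = 0)]; try by apply/matrixP => -[].
rewrite -[n.+1]/(1 + n)%N => W [W0 WD Wsc].
pose W' : set 'cV[D]_n := fun y => W (col_mx 0 y : 'cV_(1 + n)).
have [|m [k [B [C [E [G [Dn [EB GC EC GB BECG WG]]]]]]]] := IHn W'.
  split=> [|u v Wu Wv|v a Wv]; rewrite /W' ?col_mx0 //.
    by rewrite -[0]addr0 -add_col_mx; apply: WD.
  by have := Wsc _ a Wv; rewrite !rscaleE mul_col_mx mul0mx.
have [W1|nW1] := pselect (exists2 v : 'cV[D]_(1 + n), W v & v 0 0 != 0); last first.
  have W_usub (v : 'cV[D]_(1 + n)) : W v -> usubmx v = 0.
    move=> Wv; apply/matrixP => i j; rewrite !ord1 !mxE lshift0.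
    by apply: contrapT => /eqP nz; apply: nW1; exists v.
  exists m, (1 + k)%N, (col_mx 0 B : 'M_(1 + n, m)),
    (block_mx 1%:M 0 0 C : 'M_(1 + n, 1 + k)), (row_mx 0 E : 'M_(m, 1 + n)),
    (block_mx 1%:M 0 0 G : 'M_(1 + k, 1 + n)).
  split; first by rewrite addnCA Dn.
  split.
  - by rewrite mul_row_col mul0mx add0r.
  - by rewrite mulmx_block !mulmx0 !mul0mx !addr0 !add0r mul1mx GC -scalar_mx_block.
  - by rewrite mul_row_block !mulmx0 !mul0mx addr0 add0r EC row_mx0.
  - by rewrite mul_block_col !mulmx0 !mul0mx addr0 add0r GB col_mx0.
  - rewrite mul_col_row mulmx_block !mulmx0 !mul0mx !addr0 !add0r mul1mx.
    by rewrite add_block_mx !addr0 add0r BECG -scalar_mx_block.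
  move=> v; rewrite -[v](@vsubmxK _ 1 n) mul_block_col !mul0mx !mul1mx addr0 add0r.
  split=> [Wv|/eqP].
    have u0 := W_usub _ Wv; rewrite col_mxKu in u0.
    rewrite u0 in Wv *; have /WG-> : W' (dsubmx (v : 'cV_(1 + n))) by [].
    by rewrite col_mx0.
  by rewrite col_mx_eq0 => /andP[/eqP-> /eqP/WG].
case: W1 => v0 Wv0 nz_v0.
have [y0 Wy0] : exists y0, W (col_mx 1%:M y0 : 'cV_(1 + n)).
  exists (dsubmx v0 *m (v0 0 0)^-1%:M).
  have := Wsc _ (v0 0 0)^-1 Wv0; rewrite rscaleE -{1}[v0]vsubmxK mul_col_mx.
  suff -> : usubmx v0 *m (v0 0 0)^-1%:M = 1%:M by [].
  apply/matrixP => i j; rewrite !ord1 !mxE big_ord1 !mxE lshift0 !eqxx !mulr1n.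
  by rewrite mulrV // divD.
exists (1 + m)%N, k, (block_mx 1%:M 0 y0 B : 'M_(1 + n, 1 + m)),
  (col_mx 0 C : 'M_(1 + n, k)),
  (block_mx 1%:M 0 (- (E *m y0)) E : 'M_(1 + m, 1 + n)),
  (row_mx (- (G *m y0)) G : 'M_(k, 1 + n)).
split; first by rewrite -addnA Dn.
split.
- rewrite mulmx_block !mulmx0 !mul0mx !addr0 !add0r !mulmx1 EB addNr.
  by rewrite -scalar_mx_block.
- by rewrite mul_row_col mulmx0 add0r.
- by rewrite mul_block_col !mulmx0 !mul0mx !add0r EC col_mx0.
- by rewrite mul_row_block !mulmx0 mulmx1 addNr add0r GB row_mx0.
- rewrite mul_col_row mulmx_block !mulmx0 !mul0mx !mulmx1 !addr0 !add0r.
  rewrite add_block_mx !addr0 BECG !mulmxN !mulmxA -addrA -opprD.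
  by rewrite -mulmxDl BECG mul1mx subrr -scalar_mx_block.
move=> v; rewrite -[v](@vsubmxK _ 1 n) mul_row_col mulNmx.
set a := usubmx _; set y := dsubmx _.
have Wa : W (col_mx a (y0 *m a) : 'cV_(1 + n)).
  by have := Wsc _ (a 0 0) Wy0; rewrite rscaleE mul_col_mx -mx11_scalar mul1mx.
rewrite addrC -mulmxA -mulmxBr -WG /W'.
split=> [Wv|Wv].
  have := WD _ _ Wv (Wsc _ (-1) Wa); rewrite rscaleE mul_col_mx add_col_mx.
  by rewrite raddfN /= !mulmxN !mulmx1 subrr.
have := WD _ _ Wv Wa.
by rewrite add_col_mx add0r subrK.
Qed.

(** * Nilpotent matrices over a division ring *)

Lemma mx_cV_ext (D : unitRingType) m n (M N : 'M[D]_(m, n)) :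
  (forall x : 'cV_n, M *m x = N *m x) -> M = N.
Proof.
move=> eqMN; apply/matrixP => i j; have := eqMN (delta_mx j 0).
by rewrite -!colE => /matrixP/(_ i 0); rewrite !mxE.
Qed.

Lemma rsubspace_scale (D : unitRingType) n (W : set 'cV[D]_n) v a :
  rsubspace W -> W v -> W (v *m a%:M).
Proof. by case=> _ _ Wsc Wv; rewrite -rscaleE; apply: Wsc. Qed.

Lemma mx_pow_swap (D : unitRingType) m n (X : 'M[D]_(n, m)) (Y : 'M[D]_(m, n)) k :
  (X *m Y) ^+ k.+1 = X *m (Y *m X) ^+ k *m Y.
Proof.
elim: k => [|k IHk]; first by rewrite expr1 expr0 mulmx1.
by rewrite exprS IHk -mulmxE exprS -mulmxE !mulmxA.
Qed.

Lemma nilpotent_mx_swap (D : unitRingType) m n (X : 'M[D]_(n, m)) (Y : 'M[D]_(m, n)) :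
  nilpotent_mx (X *m Y) -> nilpotent_mx (Y *m X).
Proof.
by case=> k XYk0; exists k.+1; rewrite mx_pow_swap XYk0 mulmx0 mul0mx.
Qed.

(** The range of [N] is a proper subspace, because a nilpotent matrix has no
right inverse. This takes the place of a rank inequality. *)
Lemma nilpotent_mx_factor (D : unitRingType) (divD : division_ring D) n
    (N : 'M[D]_n.+1) : nilpotent_mx N ->
  exists m (X : 'M[D]_(n.+1, m)) (Y : 'M[D]_(m, n.+1)),
    (m < n.+1)%N /\ N = X *m Y.
Proof.
case=> r Nr0; pose W : set 'cV[D]_n.+1 := fun v => exists x, v = N *m x.
have W_sub : rsubspace W.
  split=> [|u v [x ->] [y ->]|v a [x ->]]; first by exists 0; rewrite mulmx0.
    by exists (x + y); rewrite mulmxDr.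
  by exists (x *m a%:M); rewrite rscaleE mulmxA.
have [m [k [B [C [E [G [Dn [_ _ _ _ BECG WG]]]]]]]] := subspace_splits divD W_sub.
case: k => [|k] in C G Dn BECG WG *.
  have W_all v : W v by apply: (WG v).2; apply/matrixP => -[].
  have /choice[R DR] : forall j, exists x, col j 1%:M = N *m x.
    by move=> j; exact: W_all.
  have : N *m (\matrix_(i, j) R j i 0) = 1%:M.
    apply/matrixP => i j; have /matrixP/(_ i 0) := DR j; rewrite !mxE => ->.
    by apply: eq_bigr => l _; rewrite mxE.
  move/(expr_right_inv r); rewrite Nr0 mul0r => /esym/eqP.
  by rewrite (oner_eq0 'M[D]_n.+1).
exists m, B, (E *m N); split; first by rewrite Dn addnS ltnS leq_addr.
rewrite -[LHS]mul1mx -BECG mulmxDl -!mulmxA.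
suff -> : G *m N = 0 by rewrite mulmx0 addr0.
by apply: mx_cV_ext => x; rewrite -mulmxA mul0mx; apply: (WG _).1; exists x.
Qed.

(** If [N = X Y] with smaller inner dimension, then [Y X] is nilpotent of that
size, and the index of [N] exceeds that of [Y X] by at most one. *)
Lemma nilpotent_mx_bound (D : unitRingType) (divD : division_ring D) n
    (N : 'M[D]_n) : nilpotent_mx N -> N ^+ n = 0.
Proof.
elim/ltn_ind: n N => -[|n] IHn N N_nil; first by apply/matrixP => -[].
have [m [X [Y [lt_mn DN]]]] := nilpotent_mx_factor divD N_nil.
have YX0 : (Y *m X) ^+ m = 0.
  by apply: IHn => //; apply: nilpotent_mx_swap; rewrite -DN.
have Nm0 : N ^+ m.+1 = 0 by rewrite DN mx_pow_swap YX0 mulmx0 mul0mx.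
have -> : N ^+ n.+1 = N ^+ (n.+1 - m.+1) * N ^+ m.+1 by rewrite -exprD subnK.
by rewrite Nm0 mulr0.
Qed.

Lemma central_scalar_mxC (D : unitRingType) (c : D) m n (X : 'M[D]_(m, n)) :
  central c -> c%:M *m X = X *m c%:M.
Proof.
move=> cC; apply/matrixP => i j; rewrite mul_scalar_mx !mxE (bigD1 j) //=.
rewrite big1 ?addr0 => [|k nkj]; first by rewrite mxE eqxx mulr1n cC.
by rewrite mxE (negPf nkj) mulr0n mulr0.
Qed.

Lemma central_scalar_nilpotent_inv (D : unitRingType) (divD : division_ring D)
    n (c : D) (N : 'M[D]_n.+1) :
  central c -> c != 0 -> nilpotent_mx N ->
  exists X, (c%:M + N) *m X = 1%:M /\ X *m (c%:M + N) = 1%:M.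
Proof.
move=> cC nz_c N_nil.
pose phi : {rmorphism center divD -> 'M[D]_n.+1} := scalar_mx \o val.
pose d : center divD := Center divD (introT (center_predP c) cC).
have phiC : forall (a : center divD) X, GRing.comm X (phi a).
  by move=> a X; apply/esym/central_scalar_mxC/center_predP/valP.
apply: (scalar_add_nilpotent_inv (d := d) phiC _ N_nil).
by apply: contra nz_c => /eqP/(congr1 val)/= ->.
Qed.

(** * Irreducible semigroups *)

Definition irreducible_mx (D : unitRingType) n (S : set 'M[D]_n) : Prop :=
  forall W : set 'cV[D]_n, rsubspace W ->
    (forall A, S A -> Defs.invariant W A) ->
    (forall v, W v -> v = 0) \/ (forall v, W v).

(** A product with a nilpotent factor is not invertible, whereas a nonzero
central scalar plus a nilpotent matrix is. *)
Lemma nilpotent_mx_ideal (D : unitRingType) (divD : division_ring D) n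
    (S : set 'M[D]_n.+1) :
  mx_semigroup S -> (forall A, S A -> central_plus_nilpotent_mx A) ->
  forall A B, S A -> S B -> nilpotent_mx A ->
    nilpotent_mx (A *m B) /\ nilpotent_mx (B *m A).
Proof.
move=> S_mul S_cn A B SA SB [k Ak0].
suff AB_nil : nilpotent_mx (A *m B) by split=> //; apply: nilpotent_mx_swap.
have [c [N [cC N_nil DAB]]] := S_cn _ (S_mul _ _ SA SB).
have [c0|nz_c] := eqVneq c 0; first by rewrite DAB c0 raddf0 add0r.
have [X [ABX _]] := central_scalar_nilpotent_inv divD cC nz_c N_nil.
have := @expr_right_inv _ A (B *m X) k; rewrite Ak0 mul0r -mulmxE mulmxA -DAB in ABX *.
by move/(_ ABX)/esym/eqP; rewrite (oner_eq0 'M[D]_n.+1).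
Qed.

(** Rank is measured by the inner dimension of a factorization. If [A = X Y]
has the least inner dimension and [B] is nilpotent in [S], then
[A B A = X (Y B X) Y] with [Y B X] nilpotent, hence of smaller inner dimension;
so [A B A = 0]. *)
Lemma irreducible_nilpotent_eq0 (D : unitRingType) (divD : division_ring D) n
    (S : set 'M[D]_n.+1) :
  mx_semigroup S -> (forall A, S A -> central_plus_nilpotent_mx A) ->
  irreducible_mx S -> forall A, S A -> nilpotent_mx A -> A = 0.
Proof.
move=> S_mul S_cn S_irr A0 SA0 A0_nil; apply: contrapT => nz_A0.
have S_ideal := nilpotent_mx_ideal divD S_mul S_cn.
pose factors m := exists A : 'M[D]_n.+1, [/\ S A, nilpotent_mx A, A <> 0 &
  exists (X : 'M[D]_(n.+1, m)) (Y : 'M[D]_(m, n.+1)), A = X *m Y].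
have ex_factors : exists m, `[< factors m >].
  by exists n.+1; apply/asboolP; exists A0; split=> //; exists A0, 1%:M; rewrite mulmx1.
case: (ex_minnP ex_factors) => m /asboolP[A [SA A_nil nz_A [X [Y DA]]]] min_m.
have ABA B : S B -> nilpotent_mx B -> A *m B *m A = 0.
  move=> SB B_nil; apply: contrapT => nz_ABA.
  have SAB := S_mul _ _ SA SB; have [AB_nil _] := S_ideal _ _ SA SB A_nil.
  have YBX_nil : nilpotent_mx (Y *m B *m X).
    by apply: nilpotent_mx_swap; rewrite mulmxA -DA.
  case: m => [|m] in X Y DA min_m YBX_nil *.
    by case: nz_A; rewrite DA [X]thinmx0 mul0mx.
  have [m' [X' [Y' [lt_m'm DYBX]]]] := nilpotent_mx_factor divD YBX_nil.
  have /asboolP/min_m : factors m'.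
    exists (A *m B *m A); split=> //; first exact: S_mul.
      by have [] := S_ideal _ _ SAB SA AB_nil.
    exists (X *m X'), (Y' *m Y).
    by rewrite mulmxA -(mulmxA X X') -DYBX {1 2}DA !mulmxA.
  by rewrite leqNgt lt_m'm.
have AB0 B : S B -> nilpotent_mx B -> A *m B = 0.
  (* [W] contains the range of [A], hence is the whole space. *)
  pose W : set 'cV[D]_n.+1 := fun v => forall B, S B -> nilpotent_mx B -> A *m B *m v = 0.
  have [|s Ss v Wv C SC C_nil|W0|W_all] := S_irr W.
  - split=> [C _ _|u v Wu Wv C SC C_nil|v a Wv C SC C_nil]; first by rewrite mulmx0.
      by rewrite mulmxDr Wu // Wv // addr0.
    by rewrite rscaleE mulmxA Wv // mul0mx.
  - by rewrite mulmxA -(mulmxA A) Wv //; [apply: S_mul | have [] := S_ideal _ _ SC Ss C_nil].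
  - case: nz_A; apply: mx_cV_ext => x; rewrite mul0mx; apply: W0 => C SC C_nil.
    by rewrite mulmxA ABA // mul0mx.
  by move=> SB B_nil; apply: mx_cV_ext => x; rewrite mul0mx W_all.
(* [W] contains the range of [A], since [A] kills the nilpotent members, and is
   killed by [A]; irreducibility forces [A = 0]. *)
pose W : set 'cV[D]_n.+1 :=
  fun v => A *m v = 0 /\ forall s, S s -> A *m s *m v = 0.
have [|s Ss v [_ Wv]|W0|W_all] := S_irr W.
- split=> [|u v [Au Su] [Av Sv]|v a [Av Sv]]; split=> [|s Ss]; rewrite ?mulmx0 //.
  + by rewrite mulmxDr Au Av addr0.
  + by rewrite mulmxDr Su // Sv // addr0.
  + by rewrite rscaleE mulmxA Av mul0mx.
  + by rewrite rscaleE mulmxA Sv // mul0mx.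
- split=> [|t St]; first by rewrite mulmxA Wv.
  by rewrite mulmxA -(mulmxA A) Wv //; apply: S_mul.
- case: nz_A; apply: mx_cV_ext => x; rewrite mul0mx; apply: W0; split=> [|s Ss].
    by rewrite mulmxA AB0 // mul0mx.
  have [_ sA_nil] := S_ideal _ _ SA Ss A_nil.
  by rewrite mulmxA -(mulmxA A) AB0 ?mul0mx //; apply: S_mul.
by case: nz_A; apply: mx_cV_ext => x; rewrite mul0mx; case: (W_all x).
Qed.

(** The nilpotency indices are bounded by the size of the matrices, which gives
the uniform exponent that the result on abstract algebras asks for. *)
Lemma unipotent_mx_mul (D : unitRingType) (divD : division_ring D)
    (charD : char_zero D) n (U V : 'M[D]_n.+1) :
  unipotent_mx U -> unipotent_mx V ->
  (forall k, central_plus_nilpotent_mx (U ^+ k *m V)) ->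
  unipotent_mx (U *m V).
Proof.
case=> u u_nil DU [v v_nil DV] UV_cn.
pose phi : {rmorphism center divD -> 'M[D]_n.+1} := scalar_mx \o val.
have phiC : forall (a : center divD) X, GRing.comm X (phi a).
  by move=> a X; apply/esym/central_scalar_mxC/center_predP/valP.
have F0 : [pchar center divD] =i pred0.
  move=> p; apply/negP => /andP[p_pr /eqP/(congr1 val)].
  rewrite raddfMn /= => p0; have := charD p; rewrite !inE p_pr.
  by rewrite [p%:R](p0) eqxx.
have [|r UV1] := @unipotent_product _ _ phi F0 phiC u v n.+1 u_nil v_nil.
  move=> k; have [c [N [cC N_nil DUV]]] := UV_cn k.
  exists (Center divD (introT (center_predP c) cC)).
  rewrite -[1 + u]DU -[1 + v]DV -[_ * V]/(_ *m V) DUV addrC.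
  by rewrite [phi _]/(c%:M) addKr nilpotent_mx_bound.
exists (U *m V - 1%:M); last by rewrite addrC subrK.
by exists r; rewrite DU DV.
Qed.

(** The chain of the semigroup of unipotent parts serves for [S]: a subspace
invariant under [U] is invariant under [c U], as [c] is central. *)
Lemma irreducible_triangularizable (D : unitRingType) (divD : division_ring D)
    (charD : char_zero D) n (S : set 'M[D]_n.+1)
    (unipD : forall T : set 'M[D]_n.+1, mx_semigroup T ->
       (forall A, T A -> unipotent_mx A) -> triangularizable T) :
  mx_semigroup S -> (forall A, S A -> central_plus_nilpotent_mx A) ->
  irreducible_mx S -> triangularizable S.
Proof.
move=> S_mul S_cn S_irr.
pose T : set 'M[D]_n.+1 := fun U => unipotent_mx U /\
  exists c, [/\ central c, c != 0 & S (c%:M *m U)].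
have centralM c d : central c -> central d -> central (c * d).
  by move=> cC dC x; apply: commr_sym; apply: commrM; apply: commr_sym.
have centralV c : central c -> central c^-1.
  by move=> cC x; apply: commr_sym; apply: commrV; apply: commr_sym.
have neq0M (c d : D) : c != 0 -> d != 0 -> c * d != 0.
  move=> nz_c nz_d; apply: contra nz_d => /eqP cd0.
  by rewrite -[d]mul1r -(mulVr (divD _ nz_c)) -mulrA cd0 mulr0.
have T_pow U V c d k : central c -> c != 0 -> S (c%:M *m U) ->
    central d -> d != 0 -> S (d%:M *m V) ->
    exists e, [/\ central e, e != 0 & S (e%:M *m (U ^+ k *m V))].
  move=> cC nz_c SU dC nz_d SV; elim: k => [|k [e [eC nz_e Se]]].
    by exists d; rewrite expr0 mul1mx.
  exists (c * e); split; [exact: centralM | exact: neq0M |].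
  have := S_mul _ _ SU Se; rewrite scalar_mxM exprS -mulmxE.
  by rewrite -!mulmxA [U *m (e%:M *m _)]mulmxA -(central_scalar_mxC U eC) !mulmxA.
have T_mul : mx_semigroup T.
  move=> U V [U_uni [c [cC nz_c SU]]] [V_uni [d [dC nz_d SV]]]; split; last first.
    have [e eP] := T_pow U V c d 1%N cC nz_c SU dC nz_d SV.
    by exists e; rewrite expr1 in eP.
  apply: unipotent_mx_mul => // k.
  have [e [eC nz_e Se]] := T_pow U V c d k cC nz_c SU dC nz_d SV.
  have [f [N [fC [r Nr0] DN]]] := S_cn _ Se.
  exists (e^-1 * f), (e^-1%:M *m N); split; first by apply: centralM => //; apply: centralV.
    exists r; rewrite mulmxE exprMn_comm ?Nr0 ?mulr0 //.
    exact/central_scalar_mxC/centralV.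
  rewrite scalar_mxM -mulmxDr -DN mulmxA -scalar_mxM mulVr ?mul1mx //.
  exact: divD.
have [V [V0 V1 V_mono V_dim]] := unipD T T_mul (fun U TU => TU.1).
exists V; split=> // j; have [Vj_sub Vj_dim Vj_inv] := V_dim j; split=> // A SA.
have [c [N [cC N_nil DA]]] := S_cn A SA => v Vv.
have [c0|nz_c] := eqVneq c 0.
  have -> : A = 0.
    by apply: (irreducible_nilpotent_eq0 divD S_mul S_cn S_irr) => //; rewrite DA c0 raddf0 add0r.
  by rewrite mul0mx; case: Vj_sub.
pose U := 1%:M + c^-1%:M *m N.
have DcU : A = c%:M *m U.
  by rewrite mulmxDr mulmx1 mulmxA -scalar_mxM mulrV ?mul1mx // divD.
have TU : T U.
  split; last by exists c; rewrite -DcU.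
  exists (c^-1%:M *m N) => //; have [r Nr0] := N_nil; exists r.
  by rewrite mulmxE exprMn_comm ?Nr0 ?mulr0 //; apply/central_scalar_mxC/centralV.
rewrite DcU -mulmxA (central_scalar_mxC _ cC).
by apply: rsubspace_scale => //; apply: Vj_inv.
Qed.

(** * Gluing chains of invariant subspaces *)

Lemma rdim_mxP (D : unitRingType) n j (V : set 'cV[D]_n) :
  rdim V j <-> exists M : 'M[D]_(n, j),
    (forall x : 'cV_j, M *m x = 0 -> x = 0) /\
    (forall v, V v <-> exists x, v = M *m x).
Proof.
have lincombE (b : 'I_j -> 'cV[D]_n) x :
    rlincomb b x = (\matrix_(i, l) b l i 0) *m (\col_l x l).
  apply/matrixP => i l; rewrite ord1 summxE !mxE.
  by apply: eq_bigr => t _; rewrite !mxE.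
have colE (x : 'cV[D]_j) : x = \col_l x l 0.
  by apply/matrixP => i l; rewrite !mxE ord1.
split=> [[b [b_free ->]]|[M [M_inj VM]]].
  exists (\matrix_(i, l) b l i 0); split=> [x|v].
    rewrite {1}[x]colE -lincombE => /b_free x0.
    by apply/matrixP => i l; rewrite ord1 x0 mxE.
  split=> [[x _ <-]|[x ->]]; first by exists (\col_l x l); rewrite lincombE.
  by exists (fun l => x l 0); rewrite // lincombE -colE.
exists (fun l => col l M).
have ME : \matrix_(i, l) col l M i 0 = M by apply/matrixP => i l; rewrite !mxE.
split=> [x|].
  by rewrite lincombE ME => /M_inj/matrixP x0 k; have := x0 k 0; rewrite !mxE.
apply/seteqP; split=> v.
  by move=> /VM[x ->]; exists (fun l => x l 0); rewrite // lincombE ME -colE.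
by case=> x _ <-; apply/VM; exists (\col_l x l); rewrite lincombE ME.
Qed.

Lemma splits_invariant (D : unitRingType) n m k (W : set 'cV[D]_n) B C E G
    (A : 'M[D]_n) :
  @splits D n m k W B C E G -> Defs.invariant W A -> G *m A *m B = 0.
Proof.
case=> _ _ _ GB _ WG WA; apply: mx_cV_ext => x; rewrite mul0mx -!mulmxA.
by apply: (WG _).1; apply: WA; apply: (WG _).2; rewrite mulmxA GB mul0mx.
Qed.

Definition compress (D : unitRingType) n m (S : set 'M[D]_n) (L : 'M[D]_(m, n))
    (R : 'M[D]_(n, m)) : set 'M[D]_m := fun X => exists2 A, S A & X = L *m A *m R.

(** Compression to the subspace [W] is multiplicative because [C G A' B = 0] once
[A'] leaves [W] invariant. *)
Lemma splits_mul_sub (D : unitRingType) n m k (W : set 'cV[D]_n) B C E G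
    (A A' : 'M[D]_n) :
  @splits D n m k W B C E G -> G *m A' *m B = 0 ->
  (E *m A *m B) *m (E *m A' *m B) = E *m (A *m A') *m B.
Proof.
case=> _ _ _ _ BECG _ GAB.
have -> : E *m A *m B *m (E *m A' *m B) = E *m A *m (B *m E) *m A' *m B.
  by rewrite !mulmxA.
have -> : B *m E = 1%:M - C *m G by rewrite -BECG addrK.
rewrite mulmxBr mulmx1 !mulmxBl -!mulmxA (mulmxA G) GAB !mulmx0.
by rewrite subr0.
Qed.

Lemma splits_mul_quo (D : unitRingType) n m k (W : set 'cV[D]_n) B C E G
    (A A' : 'M[D]_n) :
  @splits D n m k W B C E G -> G *m A *m B = 0 ->
  (G *m A *m C) *m (G *m A' *m C) = G *m (A *m A') *m C.
Proof.
case=> _ _ _ _ BECG _ GAB.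
have -> : G *m A *m C *m (G *m A' *m C) = G *m A *m (C *m G) *m A' *m C.
  by rewrite !mulmxA.
have -> : C *m G = 1%:M - B *m E by rewrite -BECG addrAC subrr add0r.
by rewrite mulmxBr mulmx1 [G *m A *m (B *m E)]mulmxA GAB mul0mx subr0 !mulmxA.
Qed.

Lemma compress_central_plus_nilpotent (D : unitRingType) n m (A : 'M[D]_n)
    (L : 'M[D]_(m, n)) (R : 'M[D]_(n, m)) :
  L *m R = 1%:M ->
  (forall N : 'M[D]_n, (exists2 c, central c & A = c%:M + N) ->
     forall k, (L *m N *m R) ^+ k = L *m N ^+ k *m R) ->
  central_plus_nilpotent_mx A -> central_plus_nilpotent_mx (L *m A *m R).
Proof.
move=> LR1 powN [c [N [cC [r Nr0] DA]]].
exists c, (L *m N *m R); split=> //.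
  by exists r; rewrite powN ?Nr0 ?mulmx0 ?mul0mx //; exists c.
rewrite DA mulmxDr mulmxDl -(central_scalar_mxC _ cC) -mulmxA LR1 mulmx1.
by [].
Qed.

Lemma splits_sub_semigroup (D : unitRingType) n m k (W : set 'cV[D]_n) B C E G
    (S : set 'M[D]_n) :
  @splits D n m k W B C E G -> (forall A, S A -> Defs.invariant W A) ->
  mx_semigroup S -> (forall A, S A -> central_plus_nilpotent_mx A) ->
  mx_semigroup (compress S E B) /\
  (forall X, compress S E B X -> central_plus_nilpotent_mx X).
Proof.
move=> WS S_inv S_mul S_cn; split=> [_ _ [A SA ->] [A' SA' ->]|_ [A SA ->]].
  exists (A *m A'); first exact: S_mul.
  by rewrite (splits_mul_sub _ WS) // (splits_invariant WS) //; apply: S_inv.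
apply: compress_central_plus_nilpotent (S_cn _ SA); first by case: WS.
move=> N [c cC DA] r; have GNB : G *m N *m B = 0.
  have := splits_invariant WS (S_inv _ SA); rewrite DA mulmxDr mulmxDl.
  by rewrite -(central_scalar_mxC _ cC) -mulmxA; case: (WS) => _ _ _ -> _ _; rewrite mulmx0 add0r.
elim: r => [|r IHr]; first by rewrite !expr0 mulmx1; case: WS.
rewrite exprSr IHr -mulmxE (splits_mul_sub _ WS) //.
by rewrite exprSr.
Qed.

Lemma splits_quo_semigroup (D : unitRingType) n m k (W : set 'cV[D]_n) B C E G
    (S : set 'M[D]_n) :
  @splits D n m k W B C E G -> (forall A, S A -> Defs.invariant W A) ->
  mx_semigroup S -> (forall A, S A -> central_plus_nilpotent_mx A) ->
  mx_semigroup (compress S G C) /\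
  (forall X, compress S G C X -> central_plus_nilpotent_mx X).
Proof.
move=> WS S_inv S_mul S_cn; split=> [_ _ [A SA ->] [A' SA' ->]|_ [A SA ->]].
  exists (A *m A'); first exact: S_mul.
  by rewrite (splits_mul_quo _ WS) // (splits_invariant WS) //; apply: S_inv.
apply: compress_central_plus_nilpotent (S_cn _ SA); first by case: WS.
move=> N [c cC DA] r; have GNB : G *m N *m B = 0.
  have := splits_invariant WS (S_inv _ SA); rewrite DA mulmxDr mulmxDl.
  by rewrite -(central_scalar_mxC _ cC) -mulmxA; case: (WS) => _ _ _ -> _ _; rewrite mulmx0 add0r.
elim: r => [|r IHr]; first by rewrite !expr0 mulmx1; case: WS.
rewrite exprS IHr -mulmxE (splits_mul_quo _ WS) //.
by rewrite exprS.
Qed.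

(** The chain consists of the images under [B] of the chain of the restriction,
followed by the preimages under [G] of the chain of the quotient. *)
Lemma triangularizable_glue (D : unitRingType) m k (W : set 'cV[D]_(m + k))
    B C E G (S : set 'M[D]_(m + k)) : (0 < k)%N ->
  @splits D (m + k) m k W B C E G -> (forall A, S A -> Defs.invariant W A) ->
  triangularizable (compress S E B) -> triangularizable (compress S G C) ->
  triangularizable S.
Proof.
move=> k_gt0 WS S_inv [V1 [V1_0 V1_max V1_mono V1_dim]].
case=> V2 [V2_0 V2_max V2_mono V2_dim].
have [EB GC EC GB BECG WG] := WS.
pose V (j : 'I_(m + k).+1) : set 'cV[D]_(m + k) := fun v =>
  if (j <= m)%N then exists2 x, V1 (inord j) x & v = B *m x
  else V2 (inord (j - m)) (G *m v).
have inord_sub (j : 'I_(m + k).+1) : ((inord (j - m) : 'I_k.+1) : nat) = (j - m)%N.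
  by rewrite inordK // ltnS leq_subLR -ltnS.
exists V; split.
- apply/seteqP; split=> v; rewrite /V leq0n.
    case=> x; have -> : inord (@ord0 (m + k)) = ord0 :> 'I_m.+1.
      by apply: val_inj; rewrite /= inordK.
    by rewrite V1_0 => -> ->; rewrite mulmx0.
  move=> ->; exists 0; rewrite ?mulmx0 //; by case: (V1_dim (inord (@ord0 (m + k)))) => -[].
- apply/seteqP; split=> v // _; rewrite /V leqNgt /= -{1}[m]addn0 ltn_add2l k_gt0 /=.
  have -> : inord (m + k - m) = ord_max :> 'I_k.+1.
    by apply: val_inj; rewrite /= inordK addKn.
  by rewrite V2_max.
- move=> i j le_ij v; rewrite /V; have [le_jm|lt_mj] := leqP j m.
    rewrite (leq_trans le_ij le_jm) => -[x Vx ->]; exists x => //.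
    by apply: V1_mono Vx; rewrite !inordK ?ltnS // (leq_trans le_ij).
  have [le_im|lt_mi] := leqP i m.
    by case=> x _ ->; rewrite mulmxA GB mul0mx; case: (V2_dim (inord (j - m))) => -[].
  by apply: V2_mono; rewrite !inord_sub leq_sub2r.
move=> j; have [le_jm|lt_mj] := leqP j m.
  have [[V10 V1D V1sc] V1dim V1inv] := V1_dim (inord j).
  have VE v : V j v <-> exists2 x, V1 (inord j) x & v = B *m x.
    by rewrite /V le_jm.
  split.
  - split=> [|u v /VE[x Vx ->] /VE[y Vy ->]|v a /VE[x Vx ->]]; apply/VE.
    + by exists 0; rewrite ?mulmx0.
    + by exists (x + y); [apply: V1D | rewrite mulmxDr].
    + by exists (rscale x a); [apply: V1sc | rewrite !rscaleE mulmxA].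
  - rewrite inordK ?ltnS // in V1dim.
    have [M [M_inj VM]] := (rdim_mxP _ _).1 V1dim.
    apply/rdim_mxP; exists (B *m M); split=> [x BMx0|v].
      by apply: M_inj; rewrite -[M]mul1mx -EB -!mulmxA [B *m _]mulmxA BMx0 mulmx0.
    split=> [/VE[_ /VM[x ->] ->]|[x ->]]; first by exists x; rewrite mulmxA.
    by apply/VE; exists (M *m x); [apply/VM; exists x | rewrite mulmxA].
  - move=> A SA v /VE[x Vx ->]; apply/VE; exists (E *m A *m B *m x).
      by apply: V1inv => //; exists A.
    have ABx : W (A *m (B *m x)).
      by apply: S_inv => //; apply: (WG _).2; rewrite mulmxA GB mul0mx.
    rewrite -[LHS]mul1mx -BECG mulmxDl -(mulmxA C) (WG _).1 // mulmx0 addr0.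
    by rewrite !mulmxA.
have [V2_sub V2dim V2inv] := V2_dim (inord (j - m)).
have [V20 V2D V2sc] := V2_sub.
have VE v : V j v <-> V2 (inord (j - m)) (G *m v) by rewrite /V leqNgt lt_mj.
split.
- split=> [|u v /VE Vu /VE Vv|v a /VE Vv]; apply/VE.
  + by rewrite mulmx0.
  + by rewrite mulmxDr; apply: V2D.
  + by rewrite rscaleE mulmxA -rscaleE; apply: V2sc.
- rewrite inord_sub in V2dim.
  have [M [M_inj VM]] := (rdim_mxP _ _).1 V2dim.
  have -> : nat_of_ord j = (m + (j - m))%N by rewrite subnKC // ltnW.
  apply/rdim_mxP; exists (row_mx B (C *m M)); split=> [x|v].
    rewrite -[x]vsubmxK mul_row_col; set y := usubmx _; set z := dsubmx _ => yz0.
    have z0 : z = 0.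
      apply: M_inj; have := congr1 (mulmx G) yz0.
      by rewrite mulmx0 mulmxDr !mulmxA GB GC mul0mx mul1mx add0r.
    have := congr1 (mulmx E) yz0.
    by rewrite z0 !mulmx0 addr0 mulmxA EB mul1mx => ->; rewrite col_mx0.
  split=> [/VE/VM[x Gv]|[x ->]].
    exists (col_mx (E *m v) x); rewrite mul_row_col -mulmxA -Gv !mulmxA.
    by rewrite -mulmxDl BECG mul1mx.
  rewrite -[x]vsubmxK mul_row_col; apply/VE/VM; exists (dsubmx x).
  by rewrite mulmxDr !mulmxA GB GC mul0mx mul1mx add0r.
move=> A SA v /VE Vv; apply/VE.
have -> : G *m (A *m v) = G *m A *m C *m (G *m v).
  rewrite -[v in LHS]mul1mx -BECG mulmxDl !mulmxDr.
  by rewrite !mulmxA (splits_invariant WS (S_inv _ SA)) !mul0mx add0r.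
by apply: V2inv => //; exists A.
Qed.

Theorem mainTheorem2 (D : unitRingType)
  (divD : division_ring D) (charD : char_zero D)
  (unipD : forall (n : nat) (S : set 'M[D]_n), (0 < n)%N ->
     mx_semigroup S -> (forall A : 'M[D]_n, S A -> unipotent_mx A) ->
     triangularizable S) :
  forall (n : nat) (S : set 'M[D]_n), (0 < n)%N ->
    mx_semigroup S ->
    (forall A : 'M[D]_n, S A -> central_plus_nilpotent_mx A) ->
    triangularizable S.
Proof.
elim/ltn_ind => n IHn S n_gt0 S_mul S_cn.
have [S_irr|S_red] := pselect (irreducible_mx S).
  case: n => // n in IHn S n_gt0 S_mul S_cn S_irr *.
  apply: (irreducible_triangularizable divD charD) => // T T_mul T_uni.
  exact: unipD.
have [W [W_sub W_inv W_neq0 W_neqT]] : exists W : set 'cV[D]_n,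
    [/\ rsubspace W, forall A, S A -> Defs.invariant W A,
        ~ (forall v, W v -> v = 0) & ~ (forall v, W v)].
  apply: contrapT => noW; apply: S_red => W W_sub W_inv.
  have [?|W0] := pselect (forall v, W v -> v = 0); first by left.
  have [?|WT] := pselect (forall v, W v); first by right.
  by case: noW; exists W.
have [m [k [B [C [E [G [Dn WS]]]]]]] := subspace_splits divD W_sub.
have [EB GC EC GB BECG WG] := WS.
have m_gt0 : (0 < m)%N.
  case: (posnP m) => // m0; case: W_neq0 => v /WG Gv0.
  rewrite -[v]mul1mx -BECG mulmxDl -(mulmxA C) Gv0 mulmx0 addr0 -mulmxA.
  by rewrite (_ : E *m v = 0) ?mulmx0 //; apply/matrixP => i; have := ltn_ord i; rewrite [ltnRHS]m0.
have k_gt0 : (0 < k)%N.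
  case: (posnP k) => // k0; case: W_neqT => v; apply/WG.
  by apply/matrixP => i; have := ltn_ord i; rewrite [ltnRHS]k0.
subst n; have [sub_mul sub_cn] := splits_sub_semigroup WS W_inv S_mul S_cn.
have [quo_mul quo_cn] := splits_quo_semigroup WS W_inv S_mul S_cn.
apply: (triangularizable_glue k_gt0 WS W_inv).
  by apply: IHn => //; rewrite -[ltnLHS]addn0 ltn_add2l.
by apply: IHn => //; rewrite -[ltnLHS]add0n ltn_add2r.
Qed.
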